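(* Let $p\in\mathbb{N}$ and $d\ge2$. There exist constants $C,c,C',c'\in(0,\infty)$ depending only on $d$ and $p$ such that for all sufficiently large $k\in\mathbb{N}$ there exists a function $\phi_k:\mathcal{C}_k^{(d)}\to\mathbb{R}$ in $\mathrm{span}\{\mathbf{1}_{\mathcal{S}}:\mathcal{S}\text{ is a length-}p\text{ shuffle class in }\mathcal{C}_k^{(d)}\}$ satisfying $$\|\phi_k-\mathbf{1}\|_1:=\frac{1}{\#\mathcal{C}_k^{(d)}}\sum_{T\in\mathcal{C}_k^{(d)}}|\phi_k(T)-1|\le Ce^{-ck}$$ and $$\|\phi_k-\mathbf{1}\|_\infty:=\sup_{T\in\mathcal{C}_k^{(d)}}|\phi_k(T)-1|\le C'e^{-c'(\log k)^2}.$$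
   Context: A $d$-Catalan tree is a rooted planar tree in which every vertex has $0$ or $d$ children; $\mathcal{C}_k^{(d)}$ is the set of such trees with $k$ internal vertices, and $\mathbf{1}$ is the constant function $1$ on it. For a path $(v_0,\dots,v_p)$ in $T\in\mathcal{C}_k^{(d)}$ ($v_i$ a child of $v_{i-1}$), the siblings of $v_1,\dots,v_p$ subtend $(d-1)p$ subtrees (each sibling with its descendants); the shuffle class $\mathrm{Sh}(T;v_0,\dots,v_p)$ is the set of trees in $\mathcal{C}_k^{(d)}$ obtained from $T$ by rearranging these subtrees among the sibling positions, keeping the rest fixed. A length-$p$ shuffle class is any set of this form and $\mathbf{1}_{\mathcal{S}}$ its indicator. *)

(* Defs.v *)
From Stdlib Require Import Reals List Permutation Arith ClassicalEpsilon.
Import ListNotations.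
Open Scope R_scope.

Inductive tree : Type := Leaf : tree | Node : list tree -> tree.

Fixpoint is_dtree (d : nat) (t : tree) : Prop :=
  match t with
  | Leaf => True
  | Node cs => length cs = d /\
      (fix all_d (l : list tree) : Prop :=
         match l with [] => True | c :: l' => is_dtree d c /\ all_d l' end) cs
  end.

Fixpoint internal (t : tree) : nat :=
  match t with
  | Leaf => 0%nat
  | Node cs => S ((fix s (l : list tree) : nat :=
                     match l with [] => 0%nat | c :: l' => (internal c + s l')%nat end) cs)
  end.

Definition catalan (d k : nat) (t : tree) : Prop := is_dtree d t /\ internal t = k.

(** [spine t path m]: follow the child indices [path] from the root.  The first
    [m] steps lead to v_0 (not shuffled); each later step v_{i-1} -> v_i is a
    shuffled level.  Returns [None] if the path does not exist; otherwise the
    "skeleton" (t with every sibling subtree of v_1..v_p replaced by [Leaf])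
    together with the list of the sibling subtrees (each sibling with its
    descendants). *)
Fixpoint spine (t : tree) (path : list nat) (m : nat) {struct path}
  : option (tree * list tree) :=
  match path with
  | [] => Some (t, [])
  | i :: path' =>
    match t with
    | Leaf => None
    | Node cs =>
      if Nat.ltb i (length cs) then
        match spine (nth i cs Leaf) path' (pred m) with
        | None => None
        | Some (sk, hs) =>
          match m with
          | O => Some (Node (map (fun j => if Nat.eqb j i then sk else Leaf)
                                 (seq 0 (length cs))),
                       map (fun j => nth j cs Leaf)
                           (filter (fun j => negb (Nat.eqb j i)) (seq 0 (length cs)))
                         ++ hs)
          | S _ => Some (Node (map (fun j => if Nat.eqb j i then sk else nth j cs Leaf)
                                   (seq 0 (length cs))), hs)
          end
        end
      else None
    end
  end.

(** Sh(T; v_0,...,v_p), with v_0 at address [a] and v_i = child number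
    [nth (i-1) is] of v_{i-1}: trees of C_k^(d) obtained from T by rearranging
    the sibling subtrees among the sibling positions, the rest fixed. *)
Definition shuffle_class (d k : nat) (T : tree) (a is : list nat) (T' : tree) : Prop :=
  catalan d k T' /\
  exists sk hs hs',
    spine T (a ++ is) (length a) = Some (sk, hs) /\
    spine T' (a ++ is) (length a) = Some (sk, hs') /\
    Permutation hs hs'.

Definition is_shuffle_class (d k p : nat) (S : tree -> Prop) : Prop :=
  exists (T : tree) (a is : list nat),
    catalan d k T /\ length is = p /\ spine T (a ++ is) (length a) <> None /\
    forall T', S T' <-> shuffle_class d k T a is T'.

Definition ind (P : Prop) : R :=
  if excluded_middle_informative P then 1 else 0.

Definition sumR (l : list R) : R := fold_right Rplus 0 l.

Definition in_shuffle_span (d k p : nat) (phi : tree -> R) : Prop :=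
  exists L : list (R * (tree -> Prop)),
    (forall cS, In cS L -> is_shuffle_class d k p (snd cS)) /\
    forall T, catalan d k T ->
      phi T = sumR (map (fun cS => fst cS * ind (snd cS T)) L).

Definition L1_bound (d k : nat) (phi : tree -> R) (b : R) : Prop :=
  forall s : list tree, NoDup s -> (forall T, In T s <-> catalan d k T) ->
    / INR (length s) * sumR (map (fun T => Rabs (phi T - 1)) s) <= b.

Definition Linf_bound (d k : nat) (phi : tree -> R) (b : R) : Prop :=
  forall T, catalan d k T -> Rabs (phi T - 1) <= b.

(* Main.v *)
Require Import Defs.
From Stdlib Require Import Reals List.
From Stdlib Require Import Permutation Arith Lia Lra Sorted ClassicalEpsilon.
Import ListNotations.
Open Scope R_scope.

(** Write |t| for the number of internal vertices of t, let M = 1 + d + ... + d^(p-1),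
    and let Y(t) be 1 - sum_w |t_w| / (|t| - M), where t_w runs over the subtrees p levels
    below the root of t, or 1 if |t| <= 3 M.  At most M internal vertices of t lie above
    level p, so |Y(t)| <= 1/2 in the first case.  The function phi(T) = 1 - prod_u Y(T_u),
    over the vertices u of T at depths divisible by p+1, is off from 1 by a product with
    linearly many factors at most 1/2, whatever the tree T; hence even the sup norm of
    phi - 1 decays exponentially.  To see that phi is in the span, list the vertices with
    ancestors first and telescope: phi is the sum over u of (1 - Y(T_u)) times the product
    of Y(T_v) over v before u.  In 1 - Y(T_u) = sum_w |T_uw| / (|T_u| - M), the term of w is
    constant on the shuffle classes of the path from u to uw, and so are the Y(T_v), because
    these shuffles alter subtree sizes strictly below u only. *)

(* Addresses leading out of [t] give [Leaf], of size [0]. *)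
Fixpoint sub (t : tree) (w : list nat) : tree :=
  match w, t with
  | [], _ => t
  | _ :: _, Leaf => Leaf
  | i :: w', Node cs => sub (nth i cs Leaf) w'
  end.

Fixpoint addrs (d n : nat) : list (list nat) :=
  match n with
  | O => [[]]
  | S n' => flat_map (fun i => map (cons i) (addrs d n')) (seq 0 d)
  end.

Fixpoint full_size (d n : nat) : nat :=
  match n with O => 0%nat | S n' => S (d * full_size d n') end.

Definition level_sum (d n : nat) (t : tree) : nat :=
  list_sum (map (fun w => internal (sub t w)) (addrs d n)).

(** With M = [full_size d p], a size s above 3M gives s / (s - M) <= 3/2, whence the bound 1/2 on
    [factor]. The added 1 keeps s - M positive when p = 0, where M = 0, and makes the threshold
    itself positive. *)
Definition threshold (d p : nat) : nat := (3 * full_size d p + 1)%nat.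

Definition factor (d p : nat) (t : tree) : R :=
  if threshold d p <=? internal t
  then 1 - INR (level_sum d p t) / (INR (internal t) - INR (full_size d p))
  else 1.

(* Depths are multiples of [r]; [n] bounds the number of blocks.  The preorder listing puts
   every address after its prefixes. *)
Fixpoint sites (d r n : nat) : list (list nat) :=
  match n with
  | O => []
  | S n' => [] :: flat_map (fun w => map (app w) (sites d r n')) (addrs d r)
  end.

Definition prodR (l : list R) : R := fold_right Rmult 1 l.

Definition prod_factor (d p : nat) (l : list (list nat)) (t : tree) : R :=
  prodR (map (fun u => factor d p (sub t u)) l).

(** * Trees and subtrees *)

Lemma internal_Node (cs : list tree) :
  internal (Node cs) = S (list_sum (map internal cs)).
Proof. simpl. f_equal. induction cs as [|c cs IH]; simpl; congruence. Qed.

Lemma is_dtree_Node (d : nat) (cs : list tree) :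
  is_dtree d (Node cs) <-> length cs = d /\ Forall (is_dtree d) cs.
Proof.
  simpl. split; intros [H1 H2]; split; auto; clear H1.
  - induction cs as [|c cs IH]; constructor; tauto.
  - induction H2; simpl; auto.
Qed.

Lemma map_nth_seq {A B : Type} (f : A -> B) (x : A) (l : list A) :
  map (fun i => f (nth i l x)) (seq 0 (length l)) = map f l.
Proof.
  induction l as [|a l IH]; simpl; [reflexivity|].
  rewrite <- seq_shift, map_map, IH. reflexivity.
Qed.

Lemma internal_Node_seq (cs : list tree) :
  internal (Node cs)
  = S (list_sum (map (fun i => internal (nth i cs Leaf)) (seq 0 (length cs)))).
Proof. rewrite internal_Node, map_nth_seq. reflexivity. Qed.

Lemma sub_Leaf (w : list nat) : sub Leaf w = Leaf.
Proof. destruct w; reflexivity. Qed.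

Lemma sub_app (t : tree) (u w : list nat) : sub t (u ++ w) = sub (sub t u) w.
Proof.
  revert t; induction u as [|i u IH]; intros t; [reflexivity|].
  destruct t; simpl; [now rewrite sub_Leaf | apply IH].
Qed.

Lemma is_dtree_sub (d : nat) (t : tree) (w : list nat) :
  is_dtree d t -> is_dtree d (sub t w).
Proof.
  revert t; induction w as [|i w IH]; intros t H; [exact H|].
  destruct t as [|cs]; [exact I|]. apply IH.
  apply is_dtree_Node in H as [_ H].
  destruct (Nat.lt_ge_cases i (length cs)) as [Hi|Hi].
  - rewrite Forall_forall in H. apply H, nth_In, Hi.
  - rewrite nth_overflow by exact Hi. exact I.
Qed.

Lemma internal_nth_lt (cs : list tree) (i : nat) :
  (internal (nth i cs Leaf) < internal (Node cs))%nat.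
Proof.
  rewrite internal_Node. revert i.
  induction cs as [|c cs IH]; intros [|i]; cbn [nth map list_sum fold_right].
  1,2: simpl; lia.
  - change (fold_right Nat.add 0 (map internal cs))%nat with (list_sum (map internal cs)). lia.
  - specialize (IH i).
    change (fold_right Nat.add 0 (map internal cs))%nat with (list_sum (map internal cs)). lia.
Qed.

Lemma internal_sub_le (t : tree) (w : list nat) : (internal (sub t w) <= internal t)%nat.
Proof.
  revert t; induction w as [|i w IH]; intros t; [reflexivity|].
  destruct t as [|cs]; [reflexivity|].
  specialize (IH (nth i cs Leaf)). pose proof (internal_nth_lt cs i).
  cbn [sub]. lia.
Qed.

Lemma internal_sub_pred (t : tree) (w : list nat) :
  w <> [] -> (internal (sub t w) <= pred (internal t))%nat.
Proof.
  intros Hw. destruct w as [|i w]; [congruence|].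
  destruct t as [|cs]; [simpl; lia|].
  pose proof (internal_sub_le (nth i cs Leaf) w). pose proof (internal_nth_lt cs i).
  cbn [sub]. lia.
Qed.

(** Induction on the size: the d children of a root are strictly smaller, so they come from the list
    already built. The list makes the expansion of a function in indicators of classes a finite
    sum. *)
Lemma finitely_many_trees (d k : nat) :
  exists E, forall t, is_dtree d t -> (internal t <= k)%nat -> In t E.
Proof.
  induction k as [|k [E HE]].
  - exists [Leaf]. intros [|cs] _ H; [left; reflexivity|].
    rewrite internal_Node in H. lia.
  - assert (HL : forall n, exists F, forall l : list tree,
        length l = n -> (forall t, In t l -> In t E) -> In l F).
    { induction n as [|n [F HF]].
      - exists [[]]. intros [|] Hl _; [left; reflexivity | discriminate].
      - exists (flat_map (fun t => map (cons t) F) E).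
        intros [|t l] Hl Hin; [discriminate|].
        apply in_flat_map. exists t. split; [apply Hin; left; reflexivity|].
        apply in_map, HF; [now injection Hl|].
        intros t' Ht'. apply Hin. right; exact Ht'. }
    destruct (HL d) as [F HF].
    exists (Leaf :: map Node F). intros [|cs] Hd Hs; [left; reflexivity|].
    right. apply in_map. apply is_dtree_Node in Hd as [Hl Hd]. apply HF; [exact Hl|].
    intros t Ht. rewrite Forall_forall in Hd. apply HE; [now apply Hd|].
    apply In_nth with (d := Leaf) in Ht as [i [_ <-]].
    pose proof (internal_nth_lt cs i). lia.
Qed.

(** * Addresses *)

Lemma in_addrs_length (d n : nat) (w : list nat) : In w (addrs d n) -> length w = n.
Proof.
  revert w; induction n as [|n IH]; simpl; intros w H.
  - destruct H as [<-|[]]; reflexivity.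
  - apply in_flat_map in H as [i [_ H]]. apply in_map_iff in H as [w' [<- H]].
    simpl. f_equal. auto.
Qed.

Lemma NoDup_addrs (d n : nat) : NoDup (addrs d n).
Proof.
  induction n as [|n IH]; simpl; [repeat constructor; auto|].
  assert (H : forall l, NoDup l -> NoDup (flat_map (fun i => map (cons i) (addrs d n)) l)).
  { induction l as [|i l IHl]; simpl; intros Hl; [constructor|].
    inversion_clear Hl. apply NoDup_app.
    - apply FinFun.Injective_map_NoDup; [intros x y; congruence | exact IH].
    - auto.
    - intros w Hw Hw'. apply in_map_iff in Hw as [u [<- _]].
      apply in_flat_map in Hw' as [j [Hj Hw']].
      apply in_map_iff in Hw' as [v [Hv _]]. injection Hv as -> _. contradiction. }
  apply H, seq_NoDup.
Qed.

Lemma list_sum_flat_map {A : Type} (f : A -> list nat) (l : list A) :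
  list_sum (flat_map f l) = list_sum (map (fun x => list_sum (f x)) l).
Proof. induction l as [|a l IH]; simpl; [|rewrite list_sum_app, IH]; reflexivity. Qed.

Lemma map_flat_map {A B C : Type} (g : B -> C) (f : A -> list B) (l : list A) :
  map g (flat_map f l) = flat_map (fun x => map g (f x)) l.
Proof. induction l as [|a l IH]; simpl; [|rewrite map_app, IH]; reflexivity. Qed.

Lemma level_sum_Node (d n : nat) (cs : list tree) :
  level_sum d (S n) (Node cs)
  = list_sum (map (fun i => level_sum d n (nth i cs Leaf)) (seq 0 d)).
Proof.
  unfold level_sum. simpl. rewrite map_flat_map, list_sum_flat_map.
  f_equal. apply map_ext. intros i. rewrite map_map. reflexivity.
Qed.

Lemma list_sum_zero {A : Type} (f : A -> nat) (l : list A) :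
  (forall x, f x = 0%nat) -> list_sum (map f l) = 0%nat.
Proof. intros H. induction l; simpl; [|rewrite H]; auto. Qed.

(** An internal vertex at depth at least [n] lies in exactly one of the subtrees summed over, and at
    most 1 + d + ... + d^(n-1) vertices lie above that depth. *)
Lemma level_sum_bounds (d n : nat) (t : tree) :
  is_dtree d t ->
  (level_sum d n t <= internal t <= level_sum d n t + full_size d n)%nat.
Proof.
  revert t; induction n as [|n IH]; intros t Ht.
  - unfold level_sum; simpl. lia.
  - destruct t as [|cs].
    + unfold level_sum.
      rewrite list_sum_zero by (intros; rewrite sub_Leaf; reflexivity).
      simpl; lia.
    + pose proof (is_dtree_sub d (Node cs)) as Hsub.
      apply is_dtree_Node in Ht as Ht'. destruct Ht' as [Hl _].
      rewrite level_sum_Node, internal_Node_seq, Hl.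
      change (full_size d (S n)) with (S (d * full_size d n)).
      assert (H : forall l,
        let a := list_sum (map (fun i => level_sum d n (nth i cs Leaf)) l) in
        let b := list_sum (map (fun i => internal (nth i cs Leaf)) l) in
        (a <= b <= a + length l * full_size d n)%nat).
      { induction l as [|i l IHl]; simpl; [lia|].
        specialize (IH _ (Hsub [i] Ht)). simpl in IH, IHl. lia. }
      specialize (H (seq 0 d)). rewrite length_seq in H. simpl in H. lia.
Qed.

(** * Shuffles *)

(** Only siblings of the path are replaced by [Leaf], so the subtree at the end of the path survives
    in the skeleton. Hence it is the same for all trees of a shuffle class. *)
Lemma sub_spine (t : tree) (w : list nat) (m : nat) (sk : tree) (hs : list tree) :
  spine t w m = Some (sk, hs) -> sub sk w = sub t w.
Proof.
  revert t m sk hs; induction w as [|i w IH]; simpl; intros t m sk hs H.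
  - congruence.
  - destruct t as [|cs]; [discriminate|].
    destruct (Nat.ltb_spec i (length cs)) as [Hi|]; [|discriminate].
    destruct (spine (nth i cs Leaf) w (pred m)) as [[sk' hs']|] eqn:E; [|discriminate].
    apply IH in E.
    assert (Hn : forall f : nat -> tree,
      nth i (map f (seq 0 (length cs))) Leaf = f i).
    { intros f. rewrite nth_indep with (d' := f 0%nat) by (now rewrite length_map, length_seq).
      rewrite map_nth, seq_nth by exact Hi. reflexivity. }
    destruct m; injection H as <- <-; rewrite Hn, Nat.eqb_refl; exact E.
Qed.

(** Thanks to the default [Leaf], the size at the end of a missing path is 0. This gives the
    vanishing hypothesis of [span_invariant]. *)
Lemma sub_spine_None (t : tree) (w : list nat) (m : nat) :
  spine t w m = None -> sub t w = Leaf.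
Proof.
  revert t m; induction w as [|i w IH]; simpl; intros t m H; [discriminate|].
  destruct t as [|cs]; [reflexivity|].
  destruct (Nat.ltb_spec i (length cs)) as [Hi|Hi].
  - destruct (spine (nth i cs Leaf) w (pred m)) as [[sk' hs']|] eqn:E.
    + destruct m; discriminate.
    + apply IH in E. exact E.
  - rewrite nth_overflow by exact Hi. apply sub_Leaf.
Qed.

(** Bookkeeping for one shuffled level: the child [i] on the path has size [x] in its skeleton and
    [y] in the subtrees cut off further down, while its siblings are cut off whole. *)
Lemma list_sum_split_at (f : nat -> nat) (x y i : nat) (l : list nat) :
  NoDup l -> In i l -> f i = (x + y)%nat ->
  list_sum (map f l)
  = (list_sum (map (fun j => if j =? i then x else 0) l)
     + (list_sum (map f (filter (fun j => negb (j =? i)) l)) + y))%nat.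
Proof.
  intros Hl Hi Hf.
  assert (H0 : forall l, ~ In i l ->
     list_sum (map f l)
     = (list_sum (map (fun j => if j =? i then x else 0) l)
       + (list_sum (map f (filter (fun j => negb (j =? i)) l))))%nat).
  { clear - f. induction l as [|j l IH]; simpl; intros H; [reflexivity|].
    rewrite IH by tauto.
    destruct (Nat.eqb_spec j i); [subst; tauto|]. simpl. lia. }
  induction Hl as [|j l Hj Hl IH]; simpl; [destruct Hi|].
  destruct (Nat.eqb_spec j i) as [->|Hji]; simpl.
  - rewrite (H0 l Hj), Hf. lia.
  - rewrite IH by (destruct Hi; [congruence|assumption]). lia.
Qed.

(** With [m] = 0 every level of the path is shuffled, so each internal vertex is either kept in the
    skeleton or belongs to exactly one subtree that was cut off. *)
Lemma internal_spine (t : tree) (w : list nat) (sk : tree) (hs : list tree) :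
  spine t w 0 = Some (sk, hs) ->
  internal t = (internal sk + list_sum (map internal hs))%nat.
Proof.
  revert t sk hs; induction w as [|i w IH]; intros t sk hs H.
  - injection H as <- <-. simpl. lia.
  - simpl in H. destruct t as [|cs]; [discriminate|].
    destruct (Nat.ltb_spec i (length cs)) as [Hi|]; [|discriminate].
    destruct (spine (nth i cs Leaf) w 0) as [[sk' hs']|] eqn:E; [|discriminate].
    apply IH in E. injection H as <- <-.
    rewrite internal_Node_seq, internal_Node, !map_map, map_app, list_sum_app, map_map.
    rewrite (list_sum_split_at _ _ _ i (seq 0 (length cs)) (seq_NoDup _ _)
      ltac:(apply in_seq; lia) E).
    simpl. f_equal. f_equal. f_equal. apply map_ext. intros j. now destruct (j =? i).
Qed.

(** The last hypothesis says that [b] is not strictly below v_0. Then [b] is either off the path to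
    v_0, where nothing changes, or it is v_0 or an ancestor, and its subtree contains all the
    rearranged pieces, so that only their total size matters. *)
Lemma shuffle_internal_sub (a w : list nat) (T T' sk : tree) (hs hs' : list tree)
  (b : list nat) :
  spine T (a ++ w) (length a) = Some (sk, hs) ->
  spine T' (a ++ w) (length a) = Some (sk, hs') ->
  Permutation hs hs' ->
  (forall c, c <> [] -> b <> a ++ c) ->
  internal (sub T b) = internal (sub T' b).
Proof.
  revert T T' sk hs hs' b.
  induction a as [|i a IH]; intros T T' sk hs hs' b H H' Hp Hb.
  - simpl in *. destruct b as [|j b]; [|exfalso; apply (Hb (j :: b)); congruence].
    apply internal_spine in H. apply internal_spine in H'. simpl.
    rewrite H, H'. f_equal. apply Permutation_map with (f := internal) in Hp.
    clear - Hp. induction Hp; simpl in *; lia.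
  - simpl in H, H'.
    destruct T as [|cs]; [discriminate|]. destruct T' as [|cs']; [discriminate|].
    destruct (Nat.ltb_spec i (length cs)) as [Hi|]; [|discriminate].
    destruct (Nat.ltb_spec i (length cs')) as [Hi'|]; [|discriminate].
    destruct (spine (nth i cs Leaf) (a ++ w) (length a)) as [[s h]|] eqn:E; [|discriminate].
    destruct (spine (nth i cs' Leaf) (a ++ w) (length a)) as [[s' h']|] eqn:E'; [|discriminate].
    injection H as <- <-. injection H' as Hsk <-.
    assert (Hlen : length cs' = length cs)
      by (apply (f_equal (@length tree)) in Hsk; now rewrite !length_map, !length_seq in Hsk).
    rewrite Hlen in Hsk.
    (* Above v_0 the skeleton retains the siblings, so equal skeletons force the trees to agree off
       the path. *)
    assert (Hnth : forall j, (j < length cs)%nat ->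
      (if j =? i then s' else nth j cs' Leaf) = (if j =? i then s else nth j cs Leaf)).
    { intros j Hj. apply (ext_in_map Hsk). apply in_seq. lia. }
    assert (s' = s) as ->.
    { specialize (Hnth i Hi). now rewrite Nat.eqb_refl in Hnth. }
    assert (Hj : forall j, j <> i -> nth j cs' Leaf = nth j cs Leaf).
    { intros j Hj. destruct (Nat.lt_ge_cases j (length cs)) as [Hl|Hl].
      - specialize (Hnth j Hl). apply Nat.eqb_neq in Hj. now rewrite Hj in Hnth.
      - rewrite !nth_overflow by lia. reflexivity. }
    destruct b as [|j b].
    + simpl sub. rewrite !internal_Node_seq, Hlen. f_equal. f_equal. apply map_ext.
      intros j. destruct (Nat.eq_dec j i) as [->|Hne]; [|now rewrite Hj].
      apply (IH _ _ _ _ _ [] E E' Hp).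
      intros c Hc He. symmetry in He. apply app_eq_nil in He. tauto.
    + simpl sub. destruct (Nat.eq_dec j i) as [->|Hne]; [|now rewrite Hj].
      apply (IH _ _ _ _ _ b E E' Hp).
      intros c Hc ->. apply (Hb c Hc). reflexivity.
Qed.

(** * The shuffle span *)

Lemma sumR_app (l l' : list R) : sumR (l ++ l') = sumR l + sumR l'.
Proof. induction l as [|x l IH]; simpl; [|fold (sumR (l ++ l')); rewrite IH; fold (sumR l)]; lra. Qed.

Lemma span_ext (d k p : nat) (f g : tree -> R) :
  (forall T, catalan d k T -> f T = g T) ->
  in_shuffle_span d k p f -> in_shuffle_span d k p g.
Proof.
  intros H [L [HL Hf]]. exists L. split; [exact HL|].
  intros T HT. rewrite <- H by exact HT. auto.
Qed.

Lemma span_zero (d k p : nat) : in_shuffle_span d k p (fun _ => 0).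
Proof. exists []. split; [intros _ []|reflexivity]. Qed.

Lemma span_plus (d k p : nat) (f g : tree -> R) :
  in_shuffle_span d k p f -> in_shuffle_span d k p g ->
  in_shuffle_span d k p (fun T => f T + g T).
Proof.
  intros [L [HL Hf]] [L' [HL' Hg]]. exists (L ++ L'). split.
  - intros cS H. apply in_app_or in H as [H|H]; auto.
  - intros T HT. rewrite map_app, sumR_app, Hf, Hg by exact HT. reflexivity.
Qed.

Lemma span_sum {A : Type} (d k p : nat) (f : A -> tree -> R) (l : list A) :
  (forall x, In x l -> in_shuffle_span d k p (f x)) ->
  in_shuffle_span d k p (fun T => sumR (map (fun x => f x T) l)).
Proof.
  induction l as [|x l IH]; intros H; simpl.
  - apply span_zero.
  - apply span_plus with (f := f x); [apply H; now left|]. apply IH. intros y Hy.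
    apply H. now right.
Qed.

Definition shuffle_invariant (a w : list nat) (f : tree -> R) : Prop :=
  forall T T' sk hs hs',
    spine T (a ++ w) (length a) = Some (sk, hs) ->
    spine T' (a ++ w) (length a) = Some (sk, hs') ->
    Permutation hs hs' -> f T = f T'.

Lemma ind_true (P : Prop) : P -> Defs.ind P = 1.
Proof. unfold Defs.ind. destruct (excluded_middle_informative P); tauto. Qed.

Lemma ind_false (P : Prop) : ~ P -> Defs.ind P = 0.
Proof. unfold Defs.ind. destruct (excluded_middle_informative P); tauto. Qed.

(** The classes along a fixed path partition the trees containing that path. As [f] is constant on
    each class and zero on the other trees, it is the sum over the classes of its value times the
    indicator. *)
Lemma span_invariant (d k : nat) (a w : list nat) (f : tree -> R) :
  shuffle_invariant a w f ->
  (forall T, spine T (a ++ w) (length a) = None -> f T = 0) ->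
  in_shuffle_span d k (length w) f.
Proof.
  intros Hinv H0.
  (* The sum over [L] represents [f] restricted to the union of the classes of the trees in [E];
     representatives are added one at a time. *)
  assert (HE : forall E : list tree, exists L : list (R * (tree -> Prop)),
    (forall cS, In cS L -> is_shuffle_class d k (length w) (snd cS)) /\
    forall T, catalan d k T ->
      sumR (map (fun cS => fst cS * Defs.ind (snd cS T)) L)
      = f T * Defs.ind (exists T0, In T0 E /\ catalan d k T0 /\ shuffle_class d k T0 a w T)).
  { induction E as [|T1 E [L [HL Hs]]].
    - exists []. split; [intros _ []|]. intros T _.
      rewrite ind_false by (intros [T0 [[] _]]). simpl. ring.
    (* The class of [T1] is added only if [T1] is a valid representative and no earlier class
       contains it, so that no class is counted twice. *)
    - destruct (classic (catalan d k T1 /\ spine T1 (a ++ w) (length a) <> None /\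
        ~ exists T0, In T0 E /\ catalan d k T0 /\ shuffle_class d k T0 a w T1)) as [Hn|Hn].
      + destruct Hn as [Hc [Hsp Hn]].
        exists ((f T1, shuffle_class d k T1 a w) :: L). split.
        { intros cS [<-|H]; [|auto]. exists T1, a, w. simpl. tauto. }
        intros T HT. simpl. fold (sumR (map (fun cS => fst cS * Defs.ind (snd cS T)) L)).
        rewrite Hs by exact HT.
        destruct (classic (shuffle_class d k T1 a w T)) as [H1|H1].
        * rewrite (ind_true _ H1).
          rewrite (ind_true (exists T0, (T1 = T0 \/ In T0 E) /\ _ /\ _)) by (exists T1; auto).
          rewrite ind_false.
          -- destruct H1 as [_ [sk [hs [hs' [E1 [E2 Hp]]]]]].
             rewrite (Hinv _ _ _ _ _ E1 E2 Hp). ring.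
          (* Classes along the same path that share the tree [T] coincide: the earlier class would
             contain [T1]. *)
          -- intros [T0 [Hi [Hc0 H2]]]. apply Hn. exists T0. split; [exact Hi|].
             split; [exact Hc0|]. split; [exact Hc|].
             destruct H1 as [_ [sk [hs [hs' [E1 [E2 Hp]]]]]].
             destruct H2 as [_ [sk2 [hs2 [hs2' [F1 [F2 Hp2]]]]]].
             rewrite E2 in F2. injection F2 as -> ->.
             exists sk2, hs2, hs. repeat split; auto.
             eapply perm_trans; [exact Hp2|]. now apply Permutation_sym.
        * rewrite (ind_false _ H1), Rmult_0_r, Rplus_0_l. f_equal.
          destruct (classic (exists T0, In T0 E /\ catalan d k T0 /\ shuffle_class d k T0 a w T))
            as [H2|H2].
          -- rewrite !ind_true; [reflexivity| |exact H2].
             destruct H2 as [T0 H2]. exists T0. tauto.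
          -- rewrite !ind_false; [reflexivity| |exact H2].
             intros [T0 [[<-|H3] H4]]; [tauto|]. apply H2. exists T0. tauto.
      (* Here [T1] contributes no new tree, so the union of the classes is unchanged. *)
      + exists L. split; [exact HL|]. intros T HT. rewrite Hs by exact HT. f_equal.
        destruct (classic (exists T0, In T0 E /\ catalan d k T0 /\ shuffle_class d k T0 a w T))
            as [H2|H2].
        * rewrite !ind_true; [reflexivity| |exact H2].
          destruct H2 as [T0 H2]. exists T0. simpl. tauto.
        * rewrite !ind_false; [reflexivity| |exact H2].
          intros [T0 [[<-|H3] [H4 H5]]]; [|apply H2; exists T0; tauto].
          destruct H5 as [_ [sk [hs [hs' [E1 [E2 Hp]]]]]].
          apply Hn. split; [exact H4|]. split; [congruence|].
          intros [T0 [Hi [Hc0 [_ [sk2 [hs2 [hs2' [F1 [F2 Hp2]]]]]]]]].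
          apply H2. exists T0. split; [exact Hi|]. split; [exact Hc0|].
          split; [exact HT|]. rewrite E1 in F2. injection F2 as -> ->.
          exists sk2, hs2, hs'. repeat split; auto. eapply perm_trans; eauto. }
  destruct (finitely_many_trees d k) as [E HEk].
  destruct (HE E) as [L [HL Hs]]. exists L. split; [exact HL|].
  intros T HT. rewrite Hs by exact HT.
  destruct (spine T (a ++ w) (length a)) as [[sk hs]|] eqn:Esp.
  - rewrite ind_true; [ring|]. exists T. split.
    + destruct HT as [H1 H2]. apply HEk; [exact H1|lia].
    + split; [exact HT|]. split; [exact HT|]. exists sk, hs, hs. auto.
  - rewrite (H0 T Esp). ring.
Qed.

(** * Telescoping *)

(* Under [separated p u a], shuffling strictly below [a] does not change the
   factor at [u], which depends only on the sizes at [u] and [p] levels below. *)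
Definition separated (p : nat) (u a : list nat) : Prop :=
  (forall c, c <> [] -> u <> a ++ c) /\
  forall w c, length w = p -> c <> [] -> u ++ w <> a ++ c.

Lemma factor_invariant (d p : nat) (u a w : list nat) :
  separated p u a -> shuffle_invariant a w (fun T => factor d p (sub T u)).
Proof.
  intros [Hu Huw] T T' sk hs hs' H H' Hp. unfold factor, level_sum.
  rewrite (shuffle_internal_sub a w T T' sk hs hs' u H H' Hp Hu).
  replace (map (fun v => internal (sub (sub T u) v)) (addrs d p))
    with (map (fun v => internal (sub (sub T' u) v)) (addrs d p)); [reflexivity|].
  apply map_ext_in. intros v Hv. rewrite <- !sub_app. symmetry.
  apply (shuffle_internal_sub a w T T' sk hs hs' _ H H' Hp).
  intros c Hc. apply Huw; [now apply in_addrs_length in Hv | exact Hc].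
Qed.

Lemma INR_list_sum (l : list nat) : INR (list_sum l) = sumR (map INR l).
Proof. induction l as [|x l IH]; [reflexivity|]. simpl list_sum. rewrite plus_INR, IH. reflexivity. Qed.

Lemma sumR_scal {A : Type} (c : R) (f : A -> R) (l : list A) :
  sumR (map (fun x => c * f x) l) = c * sumR (map f l).
Proof.
  induction l as [|x l IH]; simpl; [ring|].
  fold (sumR (map (fun x => c * f x) l)). fold (sumR (map f l)). rewrite IH. ring.
Qed.

(** The term [g w] has a coefficient depending only on the size at [a], times the size at the end of
    the path [w] from [a]. Both are constant on the classes of that path. The value 0 below the
    threshold matches [factor] = 1 there. *)
Lemma span_one_minus_factor (d k p : nat) (a : list nat) (F : tree -> R) :
  (forall w, length w = p -> shuffle_invariant a w F) ->
  in_shuffle_span d k p (fun T => F T * (1 - factor d p (sub T a))).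
Proof.
  intros HF.
  set (g := fun (w : list nat) (T : tree) =>
    F T * (if threshold d p <=? internal (sub T a)
      then / (INR (internal (sub T a)) - INR (full_size d p)) else 0)
    * INR (internal (sub T (a ++ w)))).
  apply span_ext with (f := fun T => sumR (map (fun w => g w T) (addrs d p))).
  - intros T _. unfold g. rewrite sumR_scal. unfold factor, level_sum.
    rewrite INR_list_sum, map_map.
    rewrite (map_ext (fun w => INR (internal (sub T (a ++ w))))
      (fun w => INR (internal (sub (sub T a) w)))) by (intros; now rewrite sub_app).
    destruct (threshold d p <=? internal (sub T a)); [unfold Rdiv|]; ring.
  - apply span_sum. intros w Hw. apply in_addrs_length in Hw. rewrite <- Hw at 1.
    apply span_invariant with (a := a).
    + intros T T' sk hs hs' H H' Hp. unfold g.
      rewrite (HF w Hw _ _ _ _ _ H H' Hp).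
      rewrite <- (sub_spine _ _ _ _ _ H), <- (sub_spine _ _ _ _ _ H').
      rewrite (shuffle_internal_sub a w T T' sk hs hs' a H H' Hp); [reflexivity|].
      intros c Hc He. apply Hc. rewrite <- (app_nil_r a) in He at 1.
      now apply app_inv_head in He.
    + intros T H. unfold g. rewrite (sub_spine_None _ _ _ H). simpl. ring.
Qed.

(** Telescoping by 1 - y z = (1 - y) + y (1 - z), where [F] accumulates the factors of the vertices
    already passed. The ordering of [l] keeps these factors invariant under shuffles below every
    later vertex. *)
Lemma span_one_minus_prod (d k p : nat) (l : list (list nat)) (F : tree -> R) :
  StronglySorted (separated p) l ->
  (forall a w, In a l -> length w = p -> shuffle_invariant a w F) ->
  in_shuffle_span d k p (fun T => F T * (1 - prod_factor d p l T)).
Proof.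
  intros Hl. revert F. induction Hl as [|a l Hl IH Ha]; intros F HF.
  - apply span_ext with (f := fun _ => 0); [|apply span_zero].
    intros T _. unfold prod_factor. simpl. ring.
  - apply span_ext with (f := fun T => F T * (1 - factor d p (sub T a))
      + (F T * factor d p (sub T a)) * (1 - prod_factor d p l T)).
    + intros T _. unfold prod_factor. simpl.
      fold (prodR (map (fun u => factor d p (sub T u)) l)). ring.
    + apply span_plus with (g := fun T => F T * factor d p (sub T a) * (1 - prod_factor d p l T)).
      * apply span_one_minus_factor. intros w Hw. apply HF; [now left|exact Hw].
      * apply IH with (F := fun T => F T * factor d p (sub T a)).
        intros b w Hb Hw T T' sk hs hs' H H' Hp.
        rewrite Forall_forall in Ha.
        rewrite (factor_invariant d p a b w (Ha b Hb) _ _ _ _ _ H H' Hp).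
        rewrite (HF b w (or_intror Hb) Hw _ _ _ _ _ H H' Hp). reflexivity.
Qed.

Lemma separated_shift (p : nat) (w u a : list nat) :
  separated p u a -> separated p (w ++ u) (w ++ a).
Proof.
  intros [H1 H2]. split.
  - intros c Hc He. rewrite <- app_assoc in He. apply app_inv_head in He. exact (H1 c Hc He).
  - intros v c Hv Hc He. rewrite <- !app_assoc in He. apply app_inv_head in He.
    exact (H2 v c Hv Hc He).
Qed.

Lemma separated_incomparable (p : nat) (w w' u a : list nat) :
  length w = length w' -> w <> w' -> separated p (w ++ u) (w' ++ a).
Proof.
  intros Hlen Hne.
  assert (H : forall x y, w ++ x <> w' ++ y).
  { intros x y He. apply Hne.
    apply (f_equal (firstn (length w))) in He.
    rewrite firstn_app, Nat.sub_diag, firstn_O, app_nil_r, firstn_all, Hlen,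
      firstn_app, Nat.sub_diag, firstn_O, app_nil_r, firstn_all in He.
    exact He. }
  split.
  - intros c _. rewrite <- app_assoc. apply H.
  - intros v c _ _. rewrite <- !app_assoc. apply H.
Qed.

Lemma separated_root (p : nat) (a : list nat) : (p < length a)%nat -> separated p [] a.
Proof.
  intros Ha. split.
  - intros c _ He. apply (f_equal (@length nat)) in He. rewrite length_app in He. simpl in He. lia.
  - intros w c Hw _ He. apply (f_equal (@length nat)) in He. rewrite !length_app in He.
    simpl in He. lia.
Qed.

Lemma StronglySorted_app_intro {A : Type} (P : A -> A -> Prop) (l l' : list A) :
  StronglySorted P l -> StronglySorted P l' ->
  (forall x y, In x l -> In y l' -> P x y) -> StronglySorted P (l ++ l').
Proof.
  intros Hl Hl'. induction Hl as [|x l Hl IH Hx]; simpl; intros H; [exact Hl'|].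
  constructor.
  - apply IH. intros; apply H; auto.
  - apply Forall_app. split; [exact Hx|]. apply Forall_forall. intros; apply H; auto.
Qed.

(** The root is separated from the other sites by depth, two sites in the same block by shifting the
    induction hypothesis, and two sites in different blocks because their prefixes of length p + 1
    differ. *)
Lemma sites_separated (d p n : nat) : StronglySorted (separated p) (sites d (S p) n).
Proof.
  induction n as [|n IH]; cbn [sites]; [constructor|].
  constructor.
  - pose proof (in_addrs_length d (S p)) as Hlen. pose proof (NoDup_addrs d (S p)) as Hnd.
    induction Hnd as [|w l Hw Hnd IHl]; cbn [flat_map]; [constructor|].
    apply StronglySorted_app_intro.
    + clear - IH. induction IH as [|a m Hm IHm Ha]; simpl; constructor; [exact IHm|].
      rewrite Forall_map. eapply Forall_impl; [|exact Ha]. intros b Hb.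
      now apply separated_shift.
    + apply IHl. intros; apply Hlen; now right.
    + intros x y Hx Hy. apply in_map_iff in Hx as [u [<- _]].
      apply in_flat_map in Hy as [w' [Hw' Hy]]. apply in_map_iff in Hy as [v [<- _]].
      apply separated_incomparable.
      * rewrite !Hlen; simpl; auto.
      * intros ->. contradiction.
  - apply Forall_forall. intros x Hx. apply in_flat_map in Hx as [w [Hw Hx]].
    apply in_map_iff in Hx as [u [<- _]]. apply in_addrs_length in Hw.
    apply separated_root. rewrite length_app. lia.
Qed.

(** * Size of the error *)

Lemma prodR_app (l l' : list R) : prodR (l ++ l') = prodR l * prodR l'.
Proof.
  induction l as [|x l IH]; simpl; [ring|].
  fold (prodR (l ++ l')). fold (prodR l). rewrite IH. ring.
Qed.

Lemma prod_factor_sites (d p r n : nat) (t : tree) :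
  prod_factor d p (sites d r (S n)) t
  = factor d p t
    * prodR (map (fun w => prod_factor d p (sites d r n) (sub t w)) (addrs d r)).
Proof.
  unfold prod_factor at 1. simpl. f_equal.
  induction (addrs d r) as [|w l IH]; [reflexivity|].
  cbn [flat_map]. rewrite map_app.
  change (fold_right Rmult 1) with prodR in *.
  rewrite prodR_app, IH, map_map. simpl. f_equal.
  unfold prod_factor. f_equal. apply map_ext. intros u. now rewrite sub_app.
Qed.

(** With M = [full_size d p], the level sum x lies between s - M and s, and s > 3M, so x / (s - M)
    lies between 1 and 3/2. *)
Lemma factor_half (d p : nat) (t : tree) :
  is_dtree d t -> (threshold d p <= internal t)%nat -> Rabs (factor d p t) <= / 2.
Proof.
  intros Ht Hs. unfold factor. rewrite (proj2 (Nat.leb_le _ _) Hs).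
  destruct (level_sum_bounds d p t Ht) as [H1 H2]. unfold threshold in Hs.
  apply le_INR in H1, H2, Hs. rewrite !plus_INR, mult_INR in *. simpl (INR 3) in Hs. simpl (INR 1) in Hs.
  pose proof (pos_INR (full_size d p)) as H3.
  set (s := INR (internal t)) in *. set (m := INR (full_size d p)) in *.
  set (x := INR (level_sum d p t)) in *.
  assert (Hq : x / (s - m) * (s - m) = x) by (field; lra).
  set (q := x / (s - m)) in *.
  apply Rabs_le. split; nra.
Qed.

Lemma factor_le_1 (d p : nat) (t : tree) : is_dtree d t -> Rabs (factor d p t) <= 1.
Proof.
  intros Ht. destruct (Nat.leb_spec (threshold d p) (internal t)) as [H|H].
  - pose proof (factor_half d p t Ht H). lra.
  - unfold factor. rewrite (proj2 (Nat.leb_gt _ _) H), Rabs_R1. lra.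
Qed.

Lemma Rabs_prodR_le_exp {A : Type} (f g : A -> R) (l : list A) :
  (forall x, In x l -> Rabs (f x) <= exp (g x)) ->
  Rabs (prodR (map f l)) <= exp (sumR (map g l)).
Proof.
  induction l as [|x l IH]; simpl; intros H.
  - rewrite Rabs_R1, exp_0. lra.
  - rewrite Rabs_mult, exp_plus.
    apply Rmult_le_compat; try apply Rabs_pos; [apply H; now left|].
    apply IH. intros; apply H; now right.
Qed.

Lemma Rabs_prod_factor_le_1 (d p : nat) (l : list (list nat)) (t : tree) :
  is_dtree d t -> Rabs (prod_factor d p l t) <= 1.
Proof.
  intros Ht. rewrite <- exp_0.
  (* The bound 1 becomes the exponential of a sum of zeros; the form [0 * 0] lets [sumR_scal]
     evaluate that sum. *)
  replace 0 with (sumR (map (fun _ : list nat => 0 * 0) l)) by (rewrite sumR_scal; ring).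
  apply Rabs_prodR_le_exp. intros u _. rewrite Rmult_0_l, exp_0.
  apply factor_le_1, is_dtree_sub, Ht.
Qed.

(** Descending p + 1 levels loses at most [full_size d (S p)] vertices, and each subtree reached
    costs one more [threshold] in the exponent. At this rate, the total of these losses plus 1
    corresponds to exactly the factor 1/2. *)
Definition decay_rate (d p : nat) : R :=
  ln 2 / INR (S (full_size d (S p) + threshold d p * length (addrs d (S p)))).

Lemma decay_rate_pos (d p : nat) : 0 < decay_rate d p.
Proof. apply Rdiv_lt_0_compat; [pose proof ln_lt_2; lra | apply lt_0_INR; lia]. Qed.

Lemma exp_le (x y : R) : x <= y -> exp x <= exp y.
Proof. intros [H| ->]; [left; now apply exp_increasing | apply Rle_refl]. Qed.

Lemma sumR_affine {A : Type} (c b : R) (f : A -> R) (l : list A) :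
  sumR (map (fun x => c * (f x - b)) l) = c * (sumR (map f l) - INR (length l) * b).
Proof.
  rewrite sumR_scal. f_equal. induction l as [|x l IH]; [simpl; ring|].
  cbn [map length]. rewrite S_INR. simpl.
  fold (sumR (map (fun x => f x - b) l)). fold (sumR (map f l)). rewrite IH. ring.
Qed.

(* At a large vertex the factor [1/2] pays for everything lost in passing to the
   subtrees [p+1] levels below; [decay_rate] is chosen for this to balance. *)
Lemma Rabs_prod_factor_sites (d p n : nat) (t : tree) :
  is_dtree d t -> (internal t <= n)%nat ->
  Rabs (prod_factor d p (sites d (S p) n) t)
  <= exp (- decay_rate d p * (INR (internal t) - INR (threshold d p))).
Proof.
  pose proof (decay_rate_pos d p) as Hc.
  revert t; induction n as [|n IH]; intros t Ht Hn.
  (* Below the threshold the claimed bound is at least 1, while the product is at most 1 in absolute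
     value. *)
  all: destruct (Nat.le_gt_cases (threshold d p) (internal t)) as [Hs|Hs];
    [|eapply Rle_trans; [apply Rabs_prod_factor_le_1, Ht|];
      rewrite <- exp_0; apply exp_le; apply lt_INR in Hs; nra].
  (* The threshold is positive, so a tree of size 0 cannot reach it. *)
  - unfold threshold in Hs. lia.
  - rewrite prod_factor_sites, Rabs_mult.
    assert (Hb := Rabs_prodR_le_exp
      (fun w => prod_factor d p (sites d (S p) n) (sub t w))
      (fun w => - decay_rate d p * (INR (internal (sub t w)) - INR (threshold d p)))
      (addrs d (S p))).
    cbv beta in Hb. rewrite sumR_affine in Hb.
    rewrite <- (map_map (fun w => internal (sub t w)) INR), <- INR_list_sum in Hb.
    fold (level_sum d (S p) t) in Hb.
    eapply Rle_trans.
    { apply Rmult_le_compat; try apply Rabs_pos.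
      - apply factor_half; assumption.
      - apply Hb. intros w Hw. apply IH; [now apply is_dtree_sub|].
        (* Subtrees strictly below the root of a nonempty tree are smaller, so [n] blocks suffice
           for them. *)
        assert (Hw0 : w <> []) by (apply in_addrs_length in Hw; intros ->; discriminate).
        pose proof (internal_sub_pred t w Hw0). lia. }
    clear Hb.
    set (N := (full_size d (S p) + threshold d p * length (addrs d (S p)))%nat).
    assert (HN : 0 < INR (S N)) by (apply lt_0_INR; lia).
    replace (/ 2) with (exp (- decay_rate d p * INR (S N))).
    2:{ unfold decay_rate. fold N.
        replace (- (ln 2 / INR (S N)) * INR (S N)) with (- ln 2) by (field; lra).
        rewrite exp_Ropp, exp_ln; [reflexivity|lra]. }
    rewrite <- exp_plus. apply exp_le.
    destruct (level_sum_bounds d (S p) t Ht) as [_ H2].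
    apply le_INR in H2. rewrite plus_INR in H2.
    unfold N. rewrite S_INR, plus_INR, mult_INR.
    pose proof (pos_INR (threshold d p)). nra.
Qed.

(** With y = ln k >= 0, one has k = exp(y/2)^2 >= (1 + y/2)^2 >= y^2 / 4. This converts exponential
    decay into the weaker decay in (ln k)^2. *)
Lemma ln_sqr_le (k : nat) : (1 <= k)%nat -> ln (INR k) ^ 2 / 4 <= INR k.
Proof.
  intros Hk. apply le_INR in Hk. simpl (INR 1) in Hk.
  set (x := INR k) in *.
  assert (Hy : 0 <= ln x).
  { destruct Hk as [Hk| <-]; [|rewrite ln_1; lra].
    left. rewrite <- ln_1. apply ln_increasing; lra. }
  rewrite <- (exp_ln x) at 2 by lra. set (y := ln x) in *.
  replace y with (y / 2 + y / 2) at 2 by field. rewrite exp_plus.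
  pose proof (exp_ineq1_le (y / 2)). nra.
Qed.

Lemma L1_bound_of_Linf_bound (d k : nat) (phi : tree -> R) (b : R) :
  0 <= b -> Linf_bound d k phi b -> L1_bound d k phi b.
Proof.
  intros Hb H s _ Hs.
  assert (Hsum : sumR (map (fun T => Rabs (phi T - 1)) s) <= INR (length s) * b).
  { assert (Hin : forall T, In T s -> Rabs (phi T - 1) <= b) by (intros T HT; now apply H, Hs).
    clear Hs. induction s as [|T s IH]; cbn [map length]; [simpl; lra|].
    rewrite S_INR. simpl. fold (sumR (map (fun T => Rabs (phi T - 1)) s)).
    pose proof (Hin T (or_introl eq_refl)).
    pose proof (IH (fun T' HT' => Hin T' (or_intror HT'))). lra. }
  (* For the empty list the sum is 0, so the value of [/ 0] is irrelevant. *)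
  destruct s as [|T s]; [simpl; lra|].
  assert (Hl : 0 < INR (length (T :: s))) by (apply lt_0_INR; simpl; lia).
  apply Rmult_le_reg_l with (1 := Hl). rewrite <- Rmult_assoc, Rinv_r, Rmult_1_l by lra.
  exact Hsum.
Qed.

Theorem theorem1p8 (p d : nat) (hd : (2 <= d)%nat) :
  exists C c C' c' : R, 0 < C /\ 0 < c /\ 0 < C' /\ 0 < c' /\
  exists K : nat, forall k : nat, (K <= k)%nat ->
    exists phi : tree -> R,
      in_shuffle_span d k p phi /\
      L1_bound d k phi (C * exp (- c * INR k)) /\
      Linf_bound d k phi (C' * exp (- c' * (ln (INR k)) ^ 2)).
Proof.
  (* [C] absorbs the shift by the threshold in the exponent of [Rabs_prod_factor_sites]. The same
     [C] serves both norms, and the rate [c / 4] below comes from [ln_sqr_le]. *)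
  set (c := decay_rate d p). set (C := exp (c * INR (threshold d p))).
  assert (Hc : 0 < c) by apply decay_rate_pos.
  assert (HC : 0 < C) by apply exp_pos.
  exists C, c, C, (c / 4). repeat (split; [lra|]).
  exists 1%nat. intros k Hk.
  (* A tree with k internal vertices is exhausted by k blocks of levels. *)
  exists (fun T => 1 - prod_factor d p (sites d (S p) k) T).
  assert (Hsup : Linf_bound d k (fun T => 1 - prod_factor d p (sites d (S p) k) T)
    (C * exp (- c * INR k))).
  { intros T [HT Hi].
    replace (1 - prod_factor d p (sites d (S p) k) T - 1)
      with (- prod_factor d p (sites d (S p) k) T) by ring.
    rewrite Rabs_Ropp. unfold C. rewrite <- exp_plus.
    replace (c * INR (threshold d p) + - c * INR k)
      with (- decay_rate d p * (INR (internal T) - INR (threshold d p)))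
      by (rewrite Hi; unfold c; ring).
    apply Rabs_prod_factor_sites; [exact HT|lia]. }
  split; [|split].
  - apply span_ext with (f := fun T => 1 * (1 - prod_factor d p (sites d (S p) k) T));
      [intros; ring|].
    apply (span_one_minus_prod d k p _ (fun _ => 1)); [apply sites_separated|].
    intros a w _ _ T T' sk hs hs' _ _ _. reflexivity.
  - apply L1_bound_of_Linf_bound; [|exact Hsup].
    apply Rmult_le_pos; [lra|left; apply exp_pos].
  - intros T HT. eapply Rle_trans; [apply Hsup, HT|].
    apply Rmult_le_compat_l; [lra|]. apply exp_le.
    pose proof (ln_sqr_le k Hk). nra.
Qed.
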